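(* Let $Z_{BE}(\beta,N)$ and $Z_{FD}(\beta,N)$ be the canonical partition functions of the free ideal Bose gas and the free ideal Fermi gas of $N$ particles in volume $V$, with single-particle partition function $Z(\beta)=V/\lambda^3$. Let the equation of state be $P=\frac1\beta\frac{\partial\ln Z}{\partial V}$ (with $Z=Z_{BE}(\beta,N)$ or $Z_{FD}(\beta,N)$) and define the virial coefficients $a_n$ by the virial expansion $$\frac{PV}{NkT}=\sum_{n}a_n\left(\frac{N\lambda^3}{V}\right)^{n-1},\qquad \beta=\frac{1}{kT}.$$ Then the second virial coefficients of the ideal Bose and Fermi gases are $$a_2=\pm\frac{1}{2^{5/2}}\left(1-\frac1N\right),$$ where ''$+$'' stands for Bose gases and ''$-$'' stands for Fermi gases. Thus $a_2$ depends on the total particle number $N$, and as $N\to\infty$ it recovers the second virial coefficient obtained in the grand canonical ensemble, $a_2^{grand}=\pm\frac{1}{2^{5/2}}$.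
   Context: $k$ is the Boltzmann constant, $T$ the temperature, and $\lambda=h\sqrt{\beta/(2\pi m)}$ the thermal wavelength ($h$ Planck's constant, $m$ the particle mass), so $Z(j\beta)=j^{-3/2}V/\lambda^3$ for $j\ge1$, with $\lambda$ evaluated at $\beta$. The canonical partition functions are $$Z_{BE}(\beta,N)=\frac{1}{N!}\det M^{-},\qquad Z_{FD}(\beta,N)=\frac1{N!}\det M^{+},$$ where $M^{\pm}$ is the $N\times N$ matrix with entries $M^{\pm}_{ij}=Z((i-j+1)\beta)$ for $j\le i$, $M^{\pm}_{i,i+1}=\pm i$, and $0$ for $j>i+1$. Their expansions in $V/\lambda^3$ begin $$\frac{1}{N!}\left(\frac{V}{\lambda^3}\right)^N\pm\frac{1}{2^{3/2}}\frac{1}{2(N-2)!}\left(\frac{V}{\lambda^3}\right)^{N-1}+\cdots$$ with ''$+$'' for Bose and ''$-$'' for Fermi gases.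
   Formalization: The signs of $a_2$ and $a_2^{grand}$ are reversed to ''−'' for Bose and ''+'' for Fermi: the stated signs contradict the given definitions (for N=2 Bose, $PV/NkT=1-2^{-7/2}(2\lambda^3/V)+\cdots$). *)

(* Defs.v *)
From HB Require Import structures.
From mathcomp Require Import all_boot all_order all_algebra.
From mathcomp Require Import all_classical all_reals all_analysis.

Set Implicit Arguments.
Unset Strict Implicit.
Unset Printing Implicit Defensive.

Import Order.TTheory GRing.Theory Num.Theory.
Import numFieldNormedType.Exports.

Local Open Scope classical_set_scope.
Local Open Scope ring_scope.

Inductive statistics := Bose | Fermi.

Section IdealQuantumGas.
Context {R : realType}.
(* h: Planck's constant, m: particle mass, k: Boltzmann's constant,
   T: temperature, beta: inverse temperature 1 / (k T), V: volume,
   N: particle number, z: fugacity. *)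
Implicit Types (h m k T beta V z : R) (N : nat).

Definition stat_sign (s : statistics) : R :=
  match s with Bose => 1 | Fermi => -1 end.

Definition inv_temp k T : R := 1 / (k * T).

Definition thermal_wavelength h m beta : R :=
  h * Num.sqrt (beta / (2 * pi * m)).

(* Here the wavelength is evaluated at the argument beta, so that
   Z1 h m (j%:R * beta) V = j ^ (-3/2) V / lambda ^ 3, lambda taken at beta. *)
Definition Z1 h m beta V : R := V / thermal_wavelength h m beta ^+ 3.

(* The matrix M^- (Bose) or M^+ (Fermi). Indices start at 0, so the
   superdiagonal entry of 0-based row i is -(i + 1) or +(i + 1). *)
Definition Zmatrix (s : statistics) h m beta V N : 'M[R]_N :=
  \matrix_(i < N, j < N)
    if (j <= i)%N then Z1 h m ((i - j).+1%:R * beta) V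
    else if j == i.+1 :> nat then - stat_sign s * i.+1%:R
    else 0.

(* Z_BE (s = Bose) and Z_FD (s = Fermi). *)
Definition Zcan (s : statistics) h m beta V N : R :=
  (N`!%:R)^-1 * \det (Zmatrix s h m beta V N).

Definition pressure (s : statistics) h m beta N V : R :=
  beta^-1 * (fun W : R => ln (Zcan s h m beta W N))^`()%classic V.

(* y = \sum_(n >= 1) a_n x ^ (n - 1), a convergent series; a 0 is unused. *)
Definition virial_sum (a : nat -> R) (x y : R) : Prop :=
  series (fun n => a n.+1 * x ^+ n) @ \oo --> y.

(* The expansion is a low-density one: beta and N are fixed, V is large. *)
Definition virial_expansion (s : statistics) h m k T N (a : nat -> R) : Prop :=
  let beta := inv_temp k T in
  \forall V \near +oo,
    virial_sum a (N%:R * thermal_wavelength h m beta ^+ 3 / V)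
      (pressure s h m beta N V * V / (N%:R * k * T)).

Definition Xi (s : statistics) h m beta V z : R :=
  lim (series (fun N => z ^+ N * Zcan s h m beta V N) @ \oo).

(* P V = k T ln Xi. *)
Definition grand_pressure (s : statistics) h m beta V z : R :=
  beta^-1 * ln (Xi s h m beta V z) / V.

(* <N> = z d(ln Xi)/dz at fixed beta and V. *)
Definition grand_number (s : statistics) h m beta V z : R :=
  z * (fun w : R => ln (Xi s h m beta V w))^`()%classic z.

(* Low density at fixed V and beta is the limit of small fugacity z > 0;
   the coefficients do not depend on V. *)
Definition grand_virial_expansion (s : statistics) h m k T (a : nat -> R)
    : Prop :=
  let beta := inv_temp k T in
  forall V, 0 < V -> \forall z \near 0^'+,
    virial_sum a
      (grand_number s h m beta V z * thermal_wavelength h m beta ^+ 3 / V)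
      (grand_pressure s h m beta V z * V
         / (grand_number s h m beta V z * k * T)).

(* a lists the coefficients of the expansion E: it satisfies E and any other
   solution agrees with it at every index n >= 1. *)
Definition coefficients_of (E : (nat -> R) -> Prop) (a : nat -> R) : Prop :=
  E a /\ forall b : nat -> R, E b -> forall n, (0 < n)%N -> b n = a n.

End IdealQuantumGas.

(* Main.v *)
Require Import Defs.
From HB Require Import structures.
From mathcomp Require Import all_boot all_order all_algebra.
From mathcomp Require Import all_classical all_reals all_analysis.
From mathcomp Require Import ring lra.

Set Implicit Arguments.
Unset Strict Implicit.
Unset Printing Implicit Defensive.

Import Order.TTheory GRing.Theory Num.Theory.
Import numFieldNormedType.Exports.

Local Open Scope classical_set_scope.
Local Open Scope ring_scope.

(** Write [x = V / lambda^3], [sg] for the sign of the statistics, and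
    [p(z) = \sum_k sg^(k-1) z^k / k^(5/2)], [d(z) = z p'(z)].  The determinant
    is that of a Hessenberg matrix, so [Zcan N] obeys a linear recursion in [N]
    which says that [\sum_N Zcan N z^N = exp(x p(z))].

    Canonical side: [Zcan N] is the coefficient of [z^N] in [exp(x p(z))], a
    polynomial in [x], so [PV / NkT] is a rational function of [u = 1 / x] that
    is regular at [0], and its expansion is unique.

    Grand canonical side: the virial series has to express [p(z) / d(z)] as a
    power series in [y = d(z)].  The compositional inverse [phi] of [d] is
    obtained coefficientwise and has a positive radius of convergence by a
    majorant argument; by the intermediate value theorem every small [z > 0] is
    of the form [phi(y)], and [p(phi(y)) / y] is the required series.

    All compositions of power series are handled through truncations: a sequence
    of polynomials that are bounded in the norm [\sum_i |p_i| r^i] and whose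
    coefficients stabilize has, inside the disc of radius [r], the same limit as
    the partial sums of the limit series. *)

(** * Weighted coefficient norms *)

Section PolyNorm.
Variable R : realType.
Implicit Types (p q : {poly R}) (r y : R) (c F G : nat -> R).

(** A weighted l1 norm: for [r >= 0] it is submultiplicative, bounds values on the disc of radius
    [r] and controls composition, all by coefficientwise estimates. *)
Definition poly_norm p r : R := \sum_(i < size p) `|p`_i| * r ^+ i.

Definition trunc c n : {poly R} := \poly_(i < n) c i.

Lemma poly_norm_widen n p r : (size p <= n)%N ->
  poly_norm p r = \sum_(i < n) `|p`_i| * r ^+ i.
Proof.
move=> pn; rewrite /poly_norm (big_ord_widen n (fun i => `|p`_i| * r ^+ i)) //.
rewrite big_mkcond /=; apply: eq_bigr => i _.
by case: ltnP => // pi; rewrite nth_default // normr0 mul0r.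
Qed.

Lemma poly_norm_trunc c n r :
  poly_norm (trunc c n) r = \sum_(i < n) `|c i| * r ^+ i.
Proof.
rewrite (poly_norm_widen _ (size_poly _ _)).
by apply: eq_bigr => i _; rewrite coef_poly ltn_ord.
Qed.

Lemma poly_norm0 r : poly_norm 0 r = 0.
Proof. by rewrite /poly_norm size_poly0 big_ord0. Qed.

Lemma poly_norm_ge0 p r : 0 <= r -> 0 <= poly_norm p r.
Proof. by move=> r0; apply: sumr_ge0 => i _; rewrite mulr_ge0 ?exprn_ge0. Qed.

(** The Horner step; it drives the inductions below for products, values and compositions. *)
Lemma poly_normMXaddC p (a r : R) :
  poly_norm (p * 'X + a%:P) r = poly_norm p r * r + `|a|.
Proof.
rewrite (@poly_norm_widen (size p).+1); last first.
  by rewrite size_MXaddC; case: ifP.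
rewrite big_ord_recl expr0 mulr1 coefD coefMX coefC eqxx add0r addrC.
congr (_ + _); rewrite /poly_norm mulr_suml; apply: eq_bigr => i _.
by rewrite coefD coefMX coefC /= addr0 exprSr mulrA.
Qed.

Lemma poly_normZ (a : R) p r : poly_norm (a *: p) r = `|a| * poly_norm p r.
Proof.
rewrite (@poly_norm_widen (size p)) ?size_scale_leq // mulr_sumr.
by apply: eq_bigr => i _; rewrite coefZ normrM mulrA.
Qed.

Lemma ler_poly_normD p q r : 0 <= r ->
  poly_norm (p + q) r <= poly_norm p r + poly_norm q r.
Proof.
move=> r0; pose n := maxn (size p) (size q).
rewrite !(@poly_norm_widen n) ?leq_maxl ?leq_maxr ?size_polyD // -big_split /=.
by apply: ler_sum => i _; rewrite coefD -mulrDl ler_wpM2r ?exprn_ge0 ?ler_normD.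
Qed.

Lemma poly_normN p r : poly_norm (- p) r = poly_norm p r.
Proof. by rewrite -scaleN1r poly_normZ normrN1 mul1r. Qed.

Lemma ler_poly_normM p q r : 0 <= r ->
  poly_norm (p * q) r <= poly_norm p r * poly_norm q r.
Proof.
move=> r0; elim/poly_ind: p => [|p a IH]; first by rewrite mul0r poly_norm0 mul0r.
rewrite mulrDl mulrAC mul_polyC poly_normMXaddC mulrDl.
apply: le_trans (ler_poly_normD _ _ r0) _; rewrite poly_normZ lerD2r.
have := poly_normMXaddC (p * q) 0 r; rewrite addr0 normr0 addr0 => ->.
by rewrite mulrAC ler_wpM2r.
Qed.

Lemma ler_poly_norm_horner p y r : `|y| <= r -> `|p.[y]| <= poly_norm p r.
Proof.
move=> yr; have r0 : 0 <= r by apply: le_trans yr.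
elim/poly_ind: p => [|p a IH]; first by rewrite horner0 normr0 poly_norm0.
rewrite hornerMXaddC poly_normMXaddC; apply: le_trans (ler_normD _ _) _.
by rewrite lerD2r normrM ler_pM.
Qed.

Lemma ler_poly_norm p r r' : 0 <= r -> r <= r' -> poly_norm p r <= poly_norm p r'.
Proof.
move=> r0 rr'; apply: ler_sum => i _.
by rewrite ler_wpM2l // lerXn2r // nnegrE // (le_trans r0).
Qed.

(** In Horner form each factor [q] costs at most [s], so [s] becomes the radius at which [p] is
    measured. *)
Lemma ler_poly_norm_comp p q r s : 0 <= r -> poly_norm q r <= s ->
  poly_norm (p \Po q) r <= poly_norm p s.
Proof.
move=> r0 qs; elim/poly_ind: p => [|p a IH].
  by rewrite comp_poly0 !poly_norm0.
rewrite comp_poly_MXaddC poly_normMXaddC.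
apply: le_trans (ler_poly_normD _ _ r0) _; apply: lerD.
  by apply: le_trans (ler_poly_normM _ _ r0) _; rewrite ler_pM ?poly_norm_ge0.
by have := poly_normMXaddC 0 a r; rewrite mul0r add0r poly_norm0 mul0r add0r => ->.
Qed.

Lemma ler_poly_norm_drop n p r : 0 <= r ->
  poly_norm (drop_poly n p) r * r ^+ n <= poly_norm p r.
Proof.
move=> r0; rewrite (@poly_norm_widen (n + size p)%N p) ?leq_addl //.
rewrite (@poly_norm_widen (size p)) ?size_drop_poly ?leq_subr // mulr_suml.
rewrite big_split_ord /= -[leLHS]add0r lerD //.
  by apply: sumr_ge0 => i _; rewrite mulr_ge0 ?exprn_ge0.
by apply: ler_sum => i _; rewrite coef_drop_poly addnC exprD mulrA mulrAC.
Qed.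

Lemma ler_poly_norm_take n p r : 0 <= r -> poly_norm (take_poly n p) r <= poly_norm p r.
Proof.
move=> r0; rewrite (@poly_norm_widen (size p)).
  apply: ler_sum => i _; rewrite coef_take_poly; case: ifP => // _.
  by rewrite normr0 mul0r mulr_ge0 ?exprn_ge0.
by apply/leq_sizeP => j pj; rewrite coef_take_poly nth_default ?if_same.
Qed.

(** A Schwarz-type estimate: ['X^n] factors out, and the cofactor has norm at most
    [poly_norm p r / r ^+ n]. *)
Lemma horner_low_order n p y r :
  0 < r -> `|y| <= r -> (forall i, (i < n)%N -> p`_i = 0) ->
  `|p.[y]| <= poly_norm p r * (`|y| / r) ^+ n.
Proof.
move=> r0 yr p0; rewrite -(poly_take_drop n p).
have -> : take_poly n p = 0.
  by apply/polyP => i; rewrite coef_take_poly coef0; case: ifP => // /p0.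
rewrite add0r hornerM hornerXn normrM normrX expr_div_n mulrA mulrAC.
rewrite ler_wpM2r ?exprn_ge0 // ler_pdivlMr ?exprn_gt0 //.
set d := drop_poly n p.
apply: le_trans (_ : poly_norm d r * r ^+ n <= _).
  by rewrite ler_wpM2r ?exprn_ge0 ?(ltW r0) // ler_poly_norm_horner.
have := ler_poly_norm_drop n (d * 'X^n) (ltW r0).
by rewrite drop_polyMXn_id.
Qed.

Lemma horner_trunc c n y : (trunc c n).[y] = series (fun k => c k * y ^+ k) n.
Proof. by rewrite horner_poly /series /= big_mkord. Qed.

Lemma coef_trunc c n i : (i < n)%N -> (trunc c n)`_i = c i.
Proof. by move=> ni; rewrite coef_poly ni. Qed.

(** [P n] and the partial sum of order [n] agree below degree [n] and both have norm at most [A], so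
    at [y] they differ by at most [2 A (|y| / r)^n]. *)
Lemma series_of_approx c (P : nat -> {poly R}) r (A y l : R) :
  0 < r -> (forall n i, (i < n)%N -> (P n)`_i = c i) ->
  (forall n, poly_norm (P n) r <= A) -> `|y| < r ->
  (P n).[y] @[n --> \oo] --> l -> pseries c y @ \oo --> l.
Proof.
move=> r0 Pc PA yr Pl.
have r00 := ltW r0.
have tA n : poly_norm (trunc c n) r <= A.
  apply: le_trans (PA n); rewrite (_ : trunc c n = take_poly n (P n)).
    exact: ler_poly_norm_take.
  by apply/polyP => i; rewrite coef_take_poly coef_poly; case: ifP => // /Pc.
rewrite -[l]subr0.
rewrite (_ : pseries c y = (fun n => (P n).[y] - (P n - trunc c n).[y])).
  apply: cvgB => //; apply/cvgr0Pnorm_le => e e0.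
  have q1 : `| `|y| / r| < 1.
    by rewrite ger0_norm ?divr_ge0 // ltr_pdivrMr ?mul1r.
  have := cvg_geometric (A + A) q1 => /cvgr0Pnorm_le /(_ e e0).
  apply: filterS => n /=.
  rewrite /geometric /= => H; apply: le_trans H; apply: le_trans (ler_norm _).
  apply: le_trans (horner_low_order (n := n) r0 (ltW yr) _) _.
    by move=> i ni; rewrite coefB coef_trunc // Pc // subrr.
  rewrite ler_wpM2r ?exprn_ge0 ?divr_ge0 //.
  by rewrite (le_trans (ler_poly_normD _ _ r00)) // poly_normN lerD.
apply/funext => n; rewrite hornerD hornerN opprB addrCA subrr addr0.
by rewrite horner_trunc.
Qed.

End PolyNorm.

(** * Power series and their composition *)

Section PowerSeries.
Variable R : realType.
Implicit Types (p q : {poly R}) (r x y : R) (c F G : nat -> R).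

(** Absolute convergence at radius [r] with an explicit bound. In a composition the bound of the
    inner series serves as radius for the outer one. *)
Definition abs_bounded c r (A : R) := forall n, poly_norm (trunc c n) r <= A.

Lemma abs_bounded_cvg c r A : 0 <= r -> abs_bounded c r A ->
  cvgn (fun n => poly_norm (trunc c n) r).
Proof.
move=> r0 cA; apply: nondecreasing_is_cvgn.
  apply/nondecreasing_seqP => n; rewrite !poly_norm_trunc big_ord_recr /= lerDl.
  by rewrite mulr_ge0 ?exprn_ge0.
by exists A => _ [n _ <-]; exact: cA.
Qed.

Lemma abs_bounded_le c r r' A : 0 <= r -> r <= r' -> abs_bounded c r' A -> abs_bounded c r A.
Proof. by move=> r0 rr' cA n; apply: le_trans (cA n); exact: ler_poly_norm. Qed.

Lemma is_cvg_pseries_norm c r A : 0 <= r -> abs_bounded c r A ->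
  cvgn (pseries (fun n => `|c n|) r).
Proof.
move=> r0 cA.
rewrite (_ : pseries _ _ = (fun n => poly_norm (trunc c n) r)).
  exact: abs_bounded_cvg cA.
apply/funext => n; rewrite poly_norm_trunc /pseries /series /= big_mkord.
by apply: eq_bigr => i _.
Qed.

Lemma is_cvg_pseries c r A y : abs_bounded c r A -> `|y| <= r -> cvgn (pseries c y).
Proof.
move=> cA yr; apply: normed_cvg; rewrite /normed_series_of /=.
have := is_cvg_pseries_norm (normr_ge0 y) (abs_bounded_le (normr_ge0 y) yr cA).
by rewrite /pseries; under eq_fun do rewrite -normrX -normrM.
Qed.

Lemma abs_bounded_ge0 c r A : abs_bounded c r A -> 0 <= A.
Proof. by move=> /(_ 0%N); rewrite poly_norm_trunc big_ord0. Qed.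

Lemma abs_bounded_diffs c r r' A : 0 <= r -> r < r' -> abs_bounded c r' A ->
  exists B, abs_bounded (pseries_diffs c) r B.
Proof.
move=> r0 rr' cA; have r'0 : 0 < r' by apply: le_lt_trans rr'.
(* [(n + 1) r^n d <= r'^(n+1)] with [d = r' - r]: [d] times the first
   [n + 1] equal terms of the factorization of [r'^(n+1) - r^(n+1)]. *)
have key n : n.+1%:R * r ^+ n * (r' - r) <= r' ^+ n.+1.
  have : n.+1%:R * r ^+ n * (r' - r) <= r' ^+ n.+1 - r ^+ n.+1.
    rewrite subrXX mulrC ler_wpM2l ?subr_ge0 ?(ltW rr') //.
    rewrite mulr_natl -[X in _ *+ X](card_ord n.+1) -sumr_const.
    apply: ler_sum => i _; rewrite -{1}(subnKC (ltn_ord i : (i <= n)%N)) exprD mulrC.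
    by rewrite ler_wpM2r ?exprn_ge0 //= lerXn2r ?nnegrE ?(ltW rr') ?(ltW r'0).
  by move=> /le_trans; apply; rewrite gerBl exprn_ge0.
have d0 : 0 < r' - r by rewrite subr_gt0.
exists (A / (r' - r)) => n; rewrite ler_pdivlMr //.
apply: le_trans (cA n.+1); rewrite !poly_norm_trunc big_ord_recl -[leLHS]add0r lerD //.
  by rewrite mulr_ge0 ?exprn_ge0 ?(ltW r'0).
rewrite mulr_suml; apply: ler_sum => i _; rewrite lift0.
rewrite /pseries_diffs normrM ger0_norm //.
by rewrite [i.+1%:R * _]mulrC -!mulrA ler_wpM2l // !mulrA key.
Qed.

Lemma is_derive_pseries c r A x : abs_bounded c r A -> `|x| < r ->
  is_derive x (1 : R) (fun x => limn (pseries c x)) (limn (pseries (pseries_diffs c) x)).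
Proof.
move=> cA xr; have x0 := normr_ge0 x.
(* Each formal derivative costs some radius: the first is bounded at [r2], the second at [r1]. *)
pose r1 := (`|x| + r) / 2; pose r2 := (r1 + r) / 2.
have [xr1 r12 r2r] : [/\ `|x| < r1, r1 < r2 & r2 < r] by rewrite /r2 /r1; split; lra.
have r1x : `|x| <= r1 by lra.
have r10 : 0 <= r1 by lra.
have [B dB] := abs_bounded_diffs (ltW (le_lt_trans r10 r12)) r2r cA.
have [C ddC] := abs_bounded_diffs r10 r12 dB.
apply: (@pseries_snd_diffs _ _ r1); last by rewrite (ger0_norm r10).
- by apply: (is_cvg_pseries cA); rewrite ger0_norm //; lra.
- by apply: (is_cvg_pseries dB); rewrite ger0_norm //; lra.
- by apply: (is_cvg_pseries ddC); rewrite ger0_norm //; lra.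
Qed.

Lemma continuous_pseries c r A x : abs_bounded c r A -> `|x| < r ->
  {for x, continuous (fun x => limn (pseries c x))}.
Proof.
move=> cA xr; apply/differentiable_continuous/derivable1_diffP.
by have [] := is_derive_pseries cA xr.
Qed.

Lemma normr_limn_pseries c r A y : abs_bounded c r A -> `|y| <= r ->
  `|limn (pseries c y)| <= A.
Proof.
move=> cA yr.
have cn : `|pseries c y n| @[n --> \oo] --> `|limn (pseries c y)|.
  by apply: cvg_norm; exact: is_cvg_pseries cA yr.
have <- := cvg_lim (@norm_hausdorff _ _) cn.
apply: limr_le; first exact: cvgP cn.
apply: nearW => n; rewrite -[pseries c y n]horner_trunc.
exact: le_trans (ler_poly_norm_horner _ yr) (cA n).
Qed.

(** Coefficient [k] of the formal composite. Cutting at order [k.+1] is exact when [G 0 = 0]; see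
    [coef_comp_trunc]. *)
Definition comp_coef F G k : R := (trunc F k.+1 \Po trunc G k.+1)`_k.

Lemma comp_poly_congr_r p q q' : q - q' %| (p \Po q) - (p \Po q').
Proof.
elim/poly_ind: p => [|p a IH]; first by rewrite !comp_poly0 subrr dvdp0.
rewrite !comp_poly_MXaddC opprD addrACA subrr addr0.
rewrite (_ : (p \Po q) * q - _ = ((p \Po q) - (p \Po q')) * q + (p \Po q') * (q - q')); last by ring.
by apply: dvdp_add; [exact: dvdp_mulr | exact: dvdp_mull].
Qed.

Lemma trunc_congr c n m : (n <= m)%N -> 'X^n %| trunc c m - trunc c n.
Proof.
move=> nm; apply/dvdpP; exists (drop_poly n (trunc c m)).
rewrite -{1}(poly_take_drop n (trunc c m)) addrAC.
rewrite (_ : take_poly n _ = trunc c n) ?subrr ?add0r //.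
apply/polyP => i; rewrite coef_take_poly !coef_poly.
by case: ifP => // ni; rewrite (leq_trans ni nm).
Qed.

Lemma dvdXn_coef n p i : 'X^n %| p -> (i < n)%N -> p`_i = 0.
Proof. by move=> /dvdpP [q ->] ni; rewrite coefMXn ni. Qed.

Lemma dvdX_trunc G n : G 0%N = 0 -> 'X %| trunc G n.
Proof.
move=> G0; have := dvdp_XsubCl (trunc G n) 0; rewrite subr0 => ->.
by rewrite /root horner_coef0 coef_poly G0 if_same.
Qed.

(** Composition is X-adically continuous when [G 0 = 0]: a change of [F] from degree [n] on carries
    an [n]-th power of a multiple of ['X], and a change of [G] is handled by [comp_poly_congr_r]. *)
Lemma comp_trunc_congr F G n m m' : G 0%N = 0 -> (n <= m)%N -> (n <= m')%N ->
  'X^n %| (trunc F m \Po trunc G m') - (trunc F n \Po trunc G n).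
Proof.
move=> G0 nm nm'.
rewrite (_ : _ - _ = ((trunc F m - trunc F n) \Po trunc G m') +
   ((trunc F n \Po trunc G m') - (trunc F n \Po trunc G n))); last first.
  by rewrite comp_polyB; ring.
apply: dvdp_add; last exact: dvdp_trans (trunc_congr _ nm') (comp_poly_congr_r _ _ _).
apply: dvdp_trans (dvdp_comp_poly (trunc G m') (trunc_congr F nm)).
by rewrite rmorphXn /= comp_polyX dvdp_exp2r ?dvdX_trunc.
Qed.

Lemma coef_comp_trunc F G i m m' : G 0%N = 0 -> (i < m)%N -> (i < m')%N ->
  (trunc F m \Po trunc G m')`_i = comp_coef F G i.
Proof.
move=> G0 im im'; apply/eqP; rewrite -subr_eq0 -coefB.
by rewrite (dvdXn_coef (comp_trunc_congr F G0 im im')).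
Qed.

Lemma comp_coef0 F c : c 0%N = 0 -> comp_coef F c 0 = F 0%N.
Proof.
by move=> c0; rewrite /comp_coef -horner_coef0 horner_comp !horner_poly !big_ord1 c0 mul0r expr0 mulr1.
Qed.

Lemma comp_coef1 F G : G 0%N = 0 -> comp_coef F G 1 = F 1%N * G 1%N.
Proof.
move=> G0; rewrite /comp_coef [trunc F _]poly_def raddf_sum /= coef_sum.
rewrite !big_ord_recl big_ord0 /= !comp_polyZ !comp_Xn_poly !coefZ expr0 expr1.
by rewrite coef1 mulr0 add0r addr0 coef_trunc.
Qed.

Lemma comp_coef2 F G : G 0%N = 0 ->
  comp_coef F G 2 = F 1%N * G 2%N + F 2%N * G 1%N ^+ 2.
Proof.
move=> G0; rewrite /comp_coef [trunc F _]poly_def raddf_sum /= coef_sum.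
rewrite !big_ord_recl big_ord0 /= !comp_polyZ !comp_Xn_poly !coefZ expr0 expr1.
rewrite coef1 mulr0 add0r addr0 coef_trunc // expr2 coefM.
rewrite !big_ord_recl big_ord0 /= !coef_trunc // G0 /bump /=.
by rewrite mul0r add0r mulr0 !addr0.
Qed.

(** A Weierstrass test. The bound is uniform in [y], so it serves both at a limit point and at
    points moving towards it. *)
Lemma tail_bound F s A m n y : 0 <= s -> abs_bounded F s A -> (m <= n)%N -> `|y| <= s ->
  `|(trunc F n).[y] - (trunc F m).[y]| <=
  poly_norm (trunc F n) s - poly_norm (trunc F m) s.
Proof.
move=> s0 FA mn ys; rewrite !poly_norm_trunc !horner_poly.
have E (g : nat -> R) : \sum_(i < n) g i - \sum_(i < m) g i = \sum_(m <= i < n) g i.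
  by rewrite -!(big_mkord xpredT g) (@big_cat_nat _ _ _ m) //= addrAC subrr add0r.
rewrite (E (fun i => F i * y ^+ i)) (E (fun i => `|F i| * s ^+ i)).
apply: le_trans (ler_norm_sum _ _ _) _; apply: ler_sum => i _.
by rewrite normrM normrX ler_wpM2l // lerXn2r ?nnegrE.
Qed.

Lemma comp_trunc_cvg F G r s A y (w l : R) : 0 <= r ->
  abs_bounded G r s -> abs_bounded F s A -> `|y| <= r ->
  pseries G y @ \oo --> w -> pseries F w @ \oo --> l ->
  (trunc F n).[(trunc G n).[y]] @[n --> \oo] --> l.
Proof.
move=> r0 Gs FA yr Gw Fl.
have s0 := abs_bounded_ge0 Gs.
have Gns n : `|(trunc G n).[y]| <= s.
  exact: le_trans (ler_poly_norm_horner _ yr) (Gs n).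
have Gw' : (trunc G n).[y] @[n --> \oo] --> w.
  by under eq_fun do rewrite horner_trunc.
have Fl' : (trunc F n).[w] @[n --> \oo] --> l.
  by under eq_fun do rewrite horner_trunc.
have ws : `|w| <= s.
  have <- := cvg_lim (@norm_hausdorff _ _) Gw; exact: normr_limn_pseries Gs yr.
have /cvg_ex [L NL] := abs_bounded_cvg s0 FA.
have NleL n : poly_norm (trunc F n) s <= L.
  have <- := cvg_lim (@norm_hausdorff _ _) NL.
  apply: nondecreasing_cvgn_le; last by apply/cvg_ex; exists L.
  apply/nondecreasing_seqP => k; rewrite !poly_norm_trunc big_ord_recr /= lerDl.
  by rewrite mulr_ge0 ?exprn_ge0.
apply/cvgrPdist_le => e e0.
(* Four quarters: convergence at [w], the tail of [F] beyond [m] at [w] and at the moving point, and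
   continuity of the fixed polynomial [trunc F m]. *)
have e3 : 0 < e / 4 by lra.
have [m _ Hm] := (cvgrPdist_le _ _).1 NL _ e3.
have cont : {for w, continuous (horner (trunc F m))} by exact: continuous_horner.
have Fm : (trunc F m).[(trunc G n).[y]] @[n --> \oo] --> (trunc F m).[w].
  exact: (cvg_comp _ _ Gw' cont).
near=> n.
have mn : (m <= n)%N by near: n; exact: nbhs_infty_ge.
have t1 := tail_bound s0 FA mn (Gns n).
have t2 := tail_bound s0 FA mn ws.
have Nm : `|L - poly_norm (trunc F m) s| <= e / 4 by apply: Hm => /=.
have Nn := NleL n.
have h1 : `|l - (trunc F n).[w]| <= e / 4.
  by near: n; exact: (cvgrPdist_le _ _).1 Fl' _ e3.
have h2 : `|(trunc F m).[w] - (trunc F m).[(trunc G n).[y]]| <= e / 4.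
  by near: n; exact: (cvgrPdist_le _ _).1 Fm _ e3.
move: t1 t2 Nm h1 h2 Nn.
move: (trunc F n).[_] (trunc F m).[_] (trunc F n).[w] (trunc F m).[w].
move: (poly_norm _ _) (poly_norm _ _) => u v a b c d.
by rewrite !ler_norml => /andP[? ?] /andP[? ?] /andP[? ?] /andP[? ?] /andP[? ?] ?; apply/andP; split; lra.
Unshelve. all: by end_near.
Qed.

(** The composites of truncations fit [series_of_approx]: their norms at [r] stay below [A], because
    [s] bounds [G] and is the radius for [F]. *)
Lemma pseries_comp_cvg F G r s A y (w l : R) : G 0%N = 0 -> 0 < r ->
  abs_bounded G r s -> abs_bounded F s A -> `|y| < r ->
  pseries G y @ \oo --> w -> pseries F w @ \oo --> l ->
  pseries (comp_coef F G) y @ \oo --> l.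
Proof.
move=> G0 r0 Gs FA yr Gw Fl.
apply: (@series_of_approx _ _ (fun n => trunc F n \Po trunc G n) r A) => //.
- by move=> n i ni; rewrite coef_comp_trunc.
- by move=> n; apply: le_trans (ler_poly_norm_comp _ (ltW r0) (Gs n)) (FA n).
- under eq_fun do rewrite horner_comp.
  exact: comp_trunc_cvg (ltW r0) Gs FA (ltW yr) Gw Fl.
Qed.

(** * Uniqueness of power series coefficients *)

Lemma limn_pseries0 c : limn (pseries c 0) = c 0%N.
Proof.
apply/cvg_lim => //; rewrite -cvg_shiftS /=.
rewrite (_ : (fun _ => _) = fun _ => c 0%N); first exact: cvg_cst.
apply/funext => n; rewrite /pseries /series /= big_nat_recl // expr0 mulr1.
by rewrite big1 ?addr0 // => i _; rewrite expr0n mulr0.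
Qed.

Lemma is_cvg_abs_bounded c r : cvgn (pseries (fun n => `|c n|) r) ->
  exists A, abs_bounded c r A.
Proof.
move=> /cvg_seq_bounded [M [_ HM]]; exists (M + 1) => n; rewrite poly_norm_trunc.
have := HM (M + 1) _ n I; rewrite ltrDl ltr01 => /(_ isT).
rewrite /pseries /series /= big_mkord => /(le_trans _); apply.
exact: ler_norm.
Qed.

Lemma pseries_shift c (z l : R) : z != 0 -> c 0%N = 0 -> pseries c z @ \oo --> l ->
  pseries (fun n => c n.+1) z @ \oo --> l / z.
Proof.
move=> z0 c0 cl; rewrite (_ : pseries _ z = (fun n => pseries c z n.+1 / z)).
  by apply: cvgM; [rewrite (cvg_shiftS (pseries c z)) | exact: cvg_cst].
apply/funext => n; rewrite /pseries /series /= big_nat_recl // c0 mul0r add0r.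
by rewrite big_distrl /=; apply: eq_bigr => i _; rewrite exprSr mulrA mulfK.
Qed.

(** Coefficients are peeled off one at a time: [c 0] is the right limit of the sum at [0], hence
    zero; dividing by [t] gives the same situation for the shifted sequence. *)
Lemma pseries_eq0 c (d : R) : 0 < d ->
  (forall t, 0 < t -> t < d -> pseries c t @ \oo --> (0 : R)) ->
  forall n, c n = 0.
Proof.
move=> d0 c0.
suff H c' : (forall t, 0 < t -> t < d -> pseries c' t @ \oo --> (0 : R)) ->
    c' 0%N = 0 /\ forall t, 0 < t -> t < d -> pseries (fun n => c' n.+1) t @ \oo --> (0 : R).
  move=> n; elim: n c c0 => [|n IH] c c0; first by have [] := H c c0.
  by have [_ c1] := H c c0; exact: IH c1.
move=> {c c0} Hc.
have c00 : c' 0%N = 0.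
  have dd : 0 < d / 2 by lra.
  have d2 : d / 2 < d by lra.
  have d4 : `|d / 4| < `|d / 2| by rewrite !ger0_norm; lra.
  have cv : cvgn (pseries c' (d / 2)) by apply: cvgP (Hc _ dd d2).
  (* Convergence at [d / 2] yields absolute convergence at the smaller radius [d / 4], hence
     continuity at [0]. *)
  have [A cA] : exists A, abs_bounded c' (d / 4) A.
    exact: is_cvg_abs_bounded (is_cvg_pseries_inside_norm cv d4).
  have C : {for (0:R), continuous (fun x => limn (pseries c' x))}.
    by apply: (continuous_pseries cA); rewrite normr0; lra.
  have : limn (pseries c' x) @[x --> (0:R)^'+] --> c' 0%N.
    by rewrite -limn_pseries0; apply: cvg_at_right_filter; exact: C.
  move=> /(cvg_lim (@norm_hausdorff _ _)) <-.
  apply/cvg_lim => //; apply: cvg_near_cst.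
  near=> x; apply/cvg_lim => //; apply: Hc.
    by near: x; exact: nbhs_right_gt.
  by near: x; exact: nbhs_right_lt.
split=> // t t0 td; rewrite -(mul0r t^-1).
by apply: pseries_shift => //; [exact: lt0r_neq0 | exact: Hc].
Unshelve. all: by end_near.
Qed.

Lemma pseries_unique (a b : nat -> R) (d : R) (l : R -> R) : 0 < d ->
  (forall y, 0 < y -> y < d -> pseries a y @ \oo --> l y) ->
  (forall y, 0 < y -> y < d -> pseries b y @ \oo --> l y) -> forall n, a n = b n.
Proof.
move=> d0 al bl n; apply/eqP; rewrite -subr_eq0; apply/eqP.
apply: (@pseries_eq0 (fun n => a n - b n) d d0) => y y0 yd.
rewrite -(subrr (l y)) (_ : pseries _ y = (fun n => pseries a y n - pseries b y n)).
  by apply: cvgB; [exact: al | exact: bl].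
apply/funext => k; rewrite /pseries /series /= -sumrB.
by apply: eq_bigr => i _; rewrite mulrBl.
Qed.

Lemma abs_bounded_geom c (M r : R) : 0 <= r -> r < 1 -> (forall k, `|c k| <= M) ->
  abs_bounded c r (M / (1 - r)).
Proof.
move=> r0 r1 cM n; rewrite poly_norm_trunc.
have r1' : 0 < 1 - r by rewrite subr_gt0.
apply: le_trans (_ : \sum_(i < n) M * r ^+ i <= _).
  by apply: ler_sum => i _; rewrite ler_wpM2r ?exprn_ge0.
rewrite -mulr_sumr ler_wpM2l //; first exact: le_trans (normr_ge0 _) (cM 0%N).
rewrite -[leRHS]mul1r ler_pdivlMr // mulrC.
have -> : (1 - r) * \sum_(i < n) r ^+ i = 1 - r ^+ n.
  by rewrite -[RHS]opprB subrX1 -mulNr opprB.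
by rewrite gerBl exprn_ge0.
Qed.

End PowerSeries.

(** * The Hessenberg determinant *)

Section Hessenberg.
Variable R : realType.
Implicit Types (b : R) (w z c : nat -> R).

(* Multiplying by the unit lower triangular matrix with first column
   [v_j = b^j z_j] clears the first column except for its last entry. *)
Lemma det_hessenberg b w z N : b * b = 1 -> z 0%N = 1 ->
  (forall n, n.+1%:R * z n.+1 = \sum_(j < n.+1) b ^+ (n - j) * w (n - j).+1 * z j) ->
  \det (\matrix_(i < N, j < N)
     if (j <= i)%N then w (i - j).+1
     else if j == i.+1 :> nat then - b * i.+1%:R else 0) = N`!%:R * z N.
Proof.
move=> bb z0 zS; case: N => [|n]; first by rewrite det_mx00 fact0 z0 mulr1.
set M := (X in \det X).
pose v j := b ^+ j * z j.
have b2 k : b ^+ k * b ^+ k = 1 by rewrite -exprMn bb expr1n.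
(* The recursion says that row [i] of [M] annihilates [v]: the entries up to the diagonal cancel the
   superdiagonal term [- b (i + 1) v_(i+1)]. *)
have vS i : b * i.+1%:R * v i.+1 = \sum_(j < i.+1) w (i - j).+1 * v j.
  rewrite /v exprS (_ : _ * _ = b * b * b ^+ i * (i.+1%:R * z i.+1)); last by ring.
  rewrite bb mul1r zS mulr_sumr; apply: eq_bigr => j _.
  rewrite -{1}(subnK (ltn_ord j : (j <= i)%N)) exprD.
  transitivity (b ^+ (i - j) * b ^+ (i - j) * (w (i - j).+1 * (b ^+ j * z j))); first by ring.
  by rewrite b2 mul1r.
pose U := \matrix_(i < n.+1, j < n.+1)
  if j == ord0 then v i else (i == j)%:R.
have detU : \det U = 1.
  rewrite det_trig; last first.
    apply/is_trig_mxP => i j ij; rewrite mxE.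
    case: eqP => [j0|_]; first by move: ij; rewrite j0.
    by case: eqP => // ij'; move: ij; rewrite ij' ltnn.
  rewrite big_ord_recl mxE eqxx /v expr0 z0 !mulr1.
  by rewrite big1 ?mulr1 // => i _; rewrite mxE eqxx.
have MU i j : (M *m U) i j = if j == ord0 then
    (if i == ord_max then b * n.+1%:R * v n.+1 else 0) else M i j.
  rewrite mxE; case: eqP => [->|/eqP j0]; last first.
    rewrite (bigD1 j) //= !mxE (negPf j0) eqxx mulr1 big1 ?addr0 // => k kj.
    by rewrite !mxE (negPf j0) (negPf kj) mulr0.
  pose m (k : nat) : R := (if (k <= i)%N then w (i - k).+1
     else if k == i.+1 then - b * i.+1%:R else 0) * v k.
  transitivity (\sum_(0 <= k < n.+1) m k).
    by rewrite big_mkord; apply: eq_bigr => k _; rewrite !mxE eqxx.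
  have low : \sum_(0 <= k < i.+1) m k = b * i.+1%:R * v i.+1.
    by rewrite vS big_mkord; apply: eq_bigr => k _; rewrite /m -ltnS ltn_ord.
  (* The last row has no superdiagonal entry, so there the partial sum survives. *)
  case: eqP => [->|/eqP im] in low *.
    by rewrite low.
  have i_n : (i < n)%N.
    by rewrite ltn_neqAle -ltnS ltn_ord andbT; apply: contra im => /eqP im; apply/eqP/val_inj.
  rewrite (big_cat_nat (n := i.+1)) //= ?ltnW // low big_ltn //.
  rewrite {1}/m ltnn eqxx big1_seq ?addr0; first by ring.
  move=> k /=; rewrite mem_index_iota => /andP[ik _]; rewrite /m leqNgt (ltnW ik) /=.
  by rewrite gtn_eqF ?mul0r.
have -> : \det M = \det (M *m U) by rewrite det_mulmx detU mulr1.
rewrite (expand_det_col _ ord0) (bigD1 ord_max) //= big1 ?addr0; last first.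
  by move=> i im; rewrite MU eqxx (negPf im) mul0r.
rewrite MU !eqxx /cofactor addn0.
set W := row' _ _.
have WE i j : W i j = M (lift ord_max i) (lift ord0 j) by rewrite /W 2!mxE MU.
(* Without the last row and the first column, the superdiagonal of [M] becomes the diagonal of a
   lower triangular matrix. *)
have -> : \det W = (- b) ^+ n * n`!%:R.
  rewrite det_trig; last first.
    apply/is_trig_mxP => i j ij; rewrite WE mxE.
    rewrite lift_max lift0 leqNgt (leq_trans ij (leqnSn _)) /=.
    by rewrite eqSS gtn_eqF.
  transitivity (\prod_(i < n) (- b * i.+1%:R)).
    apply: eq_bigr => i _; rewrite WE mxE lift_max lift0.
    by rewrite ltnn eqxx.
  rewrite big_split /= prodr_const card_ord; congr (_ * _).
  by rewrite fact_prod natr_prod big_add1 big_mkord.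
rewrite factS natrM /v.
(* The signs come from the cofactor, the minor, [v] and [vS]; their product is an even power of
   [b]. *)
transitivity (((-1) ^+ n * (- b) ^+ n * b ^+ n.+1 * b) * (n.+1%:R * n`!%:R * z n.+1)); first by ring.
by rewrite -exprMn mulN1r opprK [_ * _ * b]mulrAC -exprSr b2 mul1r.
Qed.

(** This is [(exp c)' = c' exp c] read at degree [n], in the shape of the recursion of
    [det_hessenberg]. *)
Lemma comp_expS c n : c 0%N = 0 ->
  n.+1%:R * comp_coef (fun j => j`!%:R^-1) c n.+1 =
  \sum_(j < n.+1) (n - j).+1%:R * c (n - j).+1 * comp_coef (fun j => j`!%:R^-1) c j.
Proof.
move=> c0; set E := fun j => _.
have dE m : (trunc E m.+1)^`() = trunc E m.
  apply/polyP => i; rewrite coef_deriv !coef_poly ltnS; case: ifP => _; rewrite ?mul0rn //.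
  by rewrite /E factS natrM invfM -[LHS]mulr_natl mulrA divff ?mul1r // pnatr_eq0.
have := congr1 (fun p : {poly R} => p`_n) (deriv_comp (trunc E n.+2) (trunc c n.+2)).
rewrite dE coef_deriv coef_comp_trunc // -[X in X = _]mulr_natl => ->.
rewrite coefM; apply: eq_bigr => j _.
rewrite coef_deriv coef_trunc ?ltnS ?leq_subr //.
have jn := ltn_ord j.
by rewrite coef_comp_trunc ?(leq_trans jn) // -[X in _ * X]mulr_natl mulrC.
Qed.

(** Since [c = d * 'X] up to the relevant order, [(x c)^j / j!] contributes [x^j] times coefficient
    [n - j] of [d^j / j!]. *)
Lemma comp_exp_scale c (x : R) n : c 0%N = 0 ->
  comp_coef (fun j => j`!%:R^-1) (fun k => x * c k) n =
  (\poly_(j < n.+1) (((\poly_(i < n) c i.+1) ^+ j)`_(n - j) / j`!%:R)).[x].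
Proof.
move=> c0; rewrite /comp_coef horner_poly.
set d := \poly_(i < n) c i.+1.
have -> : trunc (fun k => x * c k) n.+1 = x *: (d * 'X).
  apply/polyP => i; rewrite coefZ coefMX !coef_poly.
  by case: i => [|i] /=; rewrite ?c0 ?mulr0 // ltnS; case: ifP => // _; rewrite mulr0.
rewrite /trunc poly_def raddf_sum coef_sum; apply: eq_bigr => j _ /=.
rewrite comp_polyZ comp_Xn_poly coefZ exprZn coefZ exprMn coefMXn ltnNge -ltnS ltn_ord /=.
by ring.
Qed.

End Hessenberg.

(** * Fugacity expansion *)

Section FugacityExpansion.
Variable R : realType.
Implicit Types (sg x y z r : R) (c : nat -> R).

Definition exp_series (j : nat) : R := j`!%:R^-1.

(* Coefficients of [<N> lambda^3 / V] and of [beta P lambda^3] in the fugacity. *)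
Definition dens_coef sg k : R :=
  if k is k'.+1 then sg ^+ k' / Num.sqrt k%:R ^+ 3 else 0.

Definition pres_coef sg k : R := dens_coef sg k / k%:R.

Lemma pseries_diffs_pres sg : pseries_diffs (pres_coef sg) = (fun k => dens_coef sg k.+1).
Proof.
by apply/funext => k; rewrite /pseries_diffs /pres_coef mulrC divfK // pnatr_eq0.
Qed.

Lemma pseries_exp x : pseries exp_series x @ \oo --> expR x.
Proof.
rewrite (_ : pseries _ _ = series (exp_coeff x)); first exact: is_cvg_series_exp_coeff.
by rewrite /pseries; congr series; apply/funext => n; rewrite /exp_coeff /exp_series /= mulrC.
Qed.

Lemma abs_bounded_exp r : exists A, abs_bounded exp_series r A.
Proof.
apply: is_cvg_abs_bounded; apply: (cvgP (expR r)).
rewrite (_ : (fun _ => _) = exp_series); first exact: pseries_exp.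
by apply/funext => n; rewrite ger0_norm // /exp_series invr_ge0.
Qed.

Lemma stat_sign_norm s : `|stat_sign s : R| = 1.
Proof. by case: s; rewrite /= ?normrN1 ?normr1. Qed.

Lemma stat_sign_sqr s : stat_sign s * stat_sign s = 1 :> R.
Proof. by case: s; rewrite /= ?mulrNN mulr1. Qed.

Lemma dens_coef_norm sg k : `|sg| = 1 -> `|dens_coef sg k| <= 1.
Proof.
move=> sg1; case: k => [|k] /=; first by rewrite normr0.
rewrite normrM normrX sg1 expr1n mul1r normfV normrX ger0_norm ?sqrtr_ge0 //.
rewrite invf_le1 ?exprn_gt0 ?sqrtr_gt0 // exprn_ege1 //.
by rewrite -[leLHS]sqrtr1 ler_wsqrtr // ler1n.
Qed.

Lemma pres_coef_norm sg k : `|sg| = 1 -> `|pres_coef sg k| <= 1.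
Proof.
move=> sg1; rewrite /pres_coef normrM.
case: k => [|k]; first by rewrite /= normr0 mul0r.
apply: mulr_ile1 => //; first exact: dens_coef_norm.
by rewrite normfV ger0_norm // invf_le1 // ler1n.
Qed.

(** A polylogarithm: [Li_(5/2)(z)] for [sg = 1] and [- Li_(5/2)(- z)] for [sg = -1].
    [fugacity_density] is its analogue of order [3/2]. *)
Definition fugacity_pressure sg z : R := limn (pseries (pres_coef sg) z).

Definition fugacity_density sg z : R := limn (pseries (dens_coef sg) z).

Lemma abs_bounded_pres sg r : `|sg| = 1 -> 0 <= r -> r < 1 ->
  abs_bounded (pres_coef sg) r (1 / (1 - r)).
Proof. by move=> sg1 r0 r1; apply: abs_bounded_geom => // k; exact: pres_coef_norm. Qed.

Lemma abs_bounded_dens sg r : `|sg| = 1 -> 0 <= r -> r < 1 ->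
  abs_bounded (dens_coef sg) r (1 / (1 - r)).
Proof. by move=> sg1 r0 r1; apply: abs_bounded_geom => // k; exact: dens_coef_norm. Qed.

Lemma cvg_pressure sg z : `|sg| = 1 -> `|z| < 1 ->
  pseries (pres_coef sg) z @ \oo --> fugacity_pressure sg z.
Proof.
by move=> sg1 z1; apply: is_cvg_pseries (abs_bounded_pres sg1 (normr_ge0 z) z1) _.
Qed.

Lemma cvg_density sg z : `|sg| = 1 -> `|z| < 1 ->
  pseries (dens_coef sg) z @ \oo --> fugacity_density sg z.
Proof.
by move=> sg1 z1; apply: is_cvg_pseries (abs_bounded_dens sg1 (normr_ge0 z) z1) _.
Qed.

Lemma is_derive_pressure sg z : `|sg| = 1 -> `|z| < 1 -> z != 0 ->
  is_derive z (1 : R) (fugacity_pressure sg) (fugacity_density sg z / z).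
Proof.
move=> sg1 z1 z0; pose r := (1 + `|z|) / 2.
have z00 := normr_ge0 z.
have [r0 r1 zr] : [/\ 0 <= r, r < 1 & `|z| < r] by rewrite /r; split; lra.
have := is_derive_pseries (abs_bounded_pres sg1 r0 r1) zr.
rewrite pseries_diffs_pres.
have H := pseries_shift z0 (erefl : dens_coef sg 0 = 0) (cvg_density sg1 z1).
by rewrite (cvg_lim (@norm_hausdorff _ _) H).
Qed.

(** The exponential has finite norm at every radius, so the bound [|x| / (1 - 2^-1)] of the inner
    series at radius [2^-1] is admissible however large [x] is. *)
Lemma pseries_grand sg x z : `|sg| = 1 -> `|z| < 2^-1 ->
  pseries (comp_coef exp_series (fun k => x * pres_coef sg k)) z @ \oo -->
  expR (x * fugacity_pressure sg z).
Proof.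
move=> sg1 z2.
have xb : abs_bounded (fun k => x * pres_coef sg k) 2^-1 (`|x| / (1 - 2^-1)).
  apply: abs_bounded_geom; [lra|lra|] => k.
  by rewrite normrM ler_piMr // pres_coef_norm.
have [A EA] := abs_bounded_exp (`|x| / (1 - 2^-1)).
have c0 : x * pres_coef sg 0 = 0 by rewrite /pres_coef mul0r mulr0.
apply: (pseries_comp_cvg c0 _ xb EA z2 _ (@pseries_exp _)); first by lra.
rewrite (_ : pseries _ z = (fun n => x * pseries (pres_coef sg) z n)).
  by apply: cvgM; [exact: cvg_cst | apply: cvg_pressure => //; lra].
apply/funext => n; rewrite /pseries /series /= big_distrr /=.
by apply: eq_bigr => i _; rewrite mulrA.
Qed.

End FugacityExpansion.

(** * Partition functions in terms of the fugacity series *)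

Section PartitionFunctions.
Variable R : realType.
Implicit Types (h m beta V z : R).

Lemma thermal_wavelength_gt0 h m beta : 0 < h -> 0 < m -> 0 < beta ->
  0 < thermal_wavelength h m beta.
Proof.
move=> h0 m0 b0; rewrite /thermal_wavelength mulr_gt0 // sqrtr_gt0 divr_gt0 //.
by rewrite !mulr_gt0 // pi_gt0.
Qed.

Lemma Z1_scale h m beta V (k : nat) :
  Z1 h m (k%:R * beta) V = V / thermal_wavelength h m beta ^+ 3 / Num.sqrt k%:R ^+ 3.
Proof.
rewrite /Z1 /thermal_wavelength -mulrA sqrtrM // mulrCA [in LHS]exprMn invfM.
by rewrite [_^-1 * _]mulrC mulrA.
Qed.

(** With [w k = x / k^(3/2)] and [b] the statistics sign, the recursion of [det_hessenberg] is
    [comp_expS] for [c = x p], because [k c_k = sg^(k-1) x / k^(3/2)]. *)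
Lemma Zcan_comp s h m beta V N :
  Zcan s h m beta V N = comp_coef (@exp_series R)
    (fun k => V / thermal_wavelength h m beta ^+ 3 * pres_coef (stat_sign s) k) N.
Proof.
set x := V / _; set c := fun k => _.
have c0 : c 0%N = 0 by rewrite /c /pres_coef mul0r mulr0.
rewrite /Zcan /Zmatrix.
under eq_mx do rewrite Z1_scale -/x.
rewrite (@det_hessenberg _ (stat_sign s) (fun k => x / Num.sqrt k%:R ^+ 3)
  (comp_coef (@exp_series R) c)).
- by rewrite mulKf // pnatr_eq0 -lt0n fact_gt0.
- exact: stat_sign_sqr.
- by rewrite comp_coef0 // /exp_series fact0 invr1.
- move=> n; rewrite comp_expS //; apply: eq_bigr => j _; congr (_ * _).
  rewrite /c /pres_coef /dens_coef; set k := (n - j)%N.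
  by rewrite mulrCA [k.+1%:R * _]mulrC divfK ?pnatr_eq0 // mulrCA.
Qed.

(** On this disc [pseries_grand] gives convergence, so the [lim] in [Xi] is a genuine sum. *)
Lemma XiE s h m beta V z : `|z| < 2^-1 ->
  Xi s h m beta V z =
  expR (V / thermal_wavelength h m beta ^+ 3 * fugacity_pressure (stat_sign s) z).
Proof.
move=> z2; rewrite /Xi (_ : (fun N => _) = (fun N => comp_coef (@exp_series R)
    (fun k => V / thermal_wavelength h m beta ^+ 3 * pres_coef (stat_sign s) k) N * z ^+ N)).
  exact/cvg_lim/(@pseries_grand _ _ (V / thermal_wavelength h m beta ^+ 3) _ (stat_sign_norm R s) z2).
by apply/funext => N; rewrite Zcan_comp mulrC.
Qed.

Lemma grand_numberE s h m beta V z : 0 < z -> z < 2^-1 ->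
  grand_number s h m beta V z =
  V / thermal_wavelength h m beta ^+ 3 * fugacity_density (stat_sign s) z.
Proof.
move=> z0 z2; rewrite /grand_number derive1E.
set x := V / _.
have z1 : `|z| < 1 by rewrite gtr0_norm //; lra.
have Dz := is_derive_pressure (stat_sign_norm R s) z1 (lt0r_neq0 z0).
have Dw : is_derive z (1 : R) (fun w => ln (Xi s h m beta V w))
    (x * (fugacity_density (stat_sign s) z / z)).
  (* The closed form of [Xi] holds only on the disc of radius [2^-1], but a derivative depends on
     values near [z] alone. *)
  apply: (@near_eq_is_derive _ _ _ (fun w => x * fugacity_pressure (stat_sign s) w)).
    near=> w; rewrite XiE ?expRK //.
    near: w; have : z \in `]- 2^-1, 2^-1[%R by rewrite in_itv /= z2 andbT; lra.
    by move=> /near_in_itvoo; apply: filterS => w; rewrite in_itv /= ltr_norml.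
rewrite derive_val.
by rewrite mulrCA [z * _]mulrC divfK // lt0r_neq0.
Unshelve. all: by end_near.
Qed.

Lemma grand_pressureE s h m beta V z : 0 < z -> z < 2^-1 ->
  grand_pressure s h m beta V z = beta^-1 *
  (V / thermal_wavelength h m beta ^+ 3 * fugacity_pressure (stat_sign s) z) / V.
Proof.
by move=> z0 z2; rewrite /grand_pressure XiE ?expRK // gtr0_norm.
Qed.

End PartitionFunctions.

(** * Compositional inverse *)

Section InverseSeries.
Variables (R : realType) (f : nat -> R).
Hypotheses (f0 : f 0%N = 0) (f1 : f 1%N = 1) (f_le1 : forall k, `|f k| <= 1).

Let eps k : R := if (k < 2)%N then 0 else f k.

(* The series [phi] with [f (phi y) = y] satisfies [phi = y - eps (phi)], and
   the coefficient [n] of the right-hand side involves only lower ones. *)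
Fixpoint inverse_poly n : {poly R} :=
  if n is n'.+1 then
    inverse_poly n' + ((n' == 1)%:R - (trunc eps n \Po inverse_poly n')`_n') *: 'X^n'
  else 0.

Definition inverse_coef n : R := (inverse_poly n.+1)`_n.

Lemma inverse_polyE n : inverse_poly n = trunc inverse_coef n.
Proof.
apply/polyP => i; rewrite coef_poly; elim: n => [|n IH]; first by rewrite coef0.
case: (ltngtP i n) => [lt_in|lt_ni|->].
- by rewrite /= coefD coefZ coefXn (ltn_eqF lt_in) mulr0 addr0 IH lt_in ltnS ltnW.
- rewrite /= coefD coefZ coefXn (gtn_eqF lt_ni) mulr0 addr0 IH.
  by rewrite ltnS (leqNgt i n) lt_ni /= ltnNge (ltnW lt_ni).
- by rewrite ltnSn.
Qed.

Lemma inverse_coef0 : inverse_coef 0 = 0.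
Proof. by rewrite /inverse_coef /= comp_poly0r coefD coef0 coefZ coefC /eps coef_poly subrr mul0r addr0. Qed.

(** [eps] starts at degree 2, so an inner change modulo ['X^n] alters the composite only modulo
    ['X^n.+1]: one order is gained. *)
Let gain n : (trunc eps n.+1 \Po trunc inverse_coef n.+1)`_n =
  (trunc eps n.+1 \Po trunc inverse_coef n)`_n.
Proof.
set a := trunc _ n.+1; set b := trunc inverse_coef n; set p := trunc eps n.+1.
have ab : 'X^n %| a - b by exact: trunc_congr.
have [q pE q0] : exists2 q, p = q * 'X & 'X %| q.
  exists (trunc (fun k => eps k.+1) n); last exact: dvdX_trunc.
  apply/polyP => i; rewrite coefMX !coef_poly; case: i => [|i] //=.
apply/eqP; rewrite -subr_eq0 -coefB; apply/eqP.
apply: (@dvdXn_coef _ n.+1) => //.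
rewrite pE !rmorphM /= !comp_polyX.
rewrite (_ : (q \Po a) * a - _ = ((q \Po a) - (q \Po b)) * a + (q \Po b) * (a - b)); last by ring.
apply: dvdp_add.
  rewrite exprSr; apply: dvdp_mul; last by rewrite dvdX_trunc // inverse_coef0.
  exact: dvdp_trans ab (comp_poly_congr_r _ _ _).
rewrite exprS; apply: dvdp_mul => //.
apply: dvdp_trans (dvdp_comp_poly b q0); rewrite comp_polyX.
by rewrite dvdX_trunc // inverse_coef0.
Qed.

Lemma inverse_coef_rec n :
  inverse_coef n = (n == 1)%:R - comp_coef eps inverse_coef n.
Proof.
rewrite {1}/inverse_coef /= inverse_polyE coefD coefZ coefXn eqxx mulr1.
by rewrite {1}/trunc coef_poly ltnn add0r /comp_coef gain.
Qed.

Lemma comp_inverse_coef n : comp_coef f inverse_coef n = (n == 1)%:R.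
Proof.
case: n => [|n]; first by rewrite comp_coef0 ?inverse_coef0 // f0.
have fE : trunc f n.+2 = trunc eps n.+2 + 'X.
  apply/polyP => -[|[|i]]; rewrite coefD coefX !coef_poly /= ?addr0 //.
  by rewrite f1 add0r.
rewrite /comp_coef fE comp_polyD comp_polyX coefD.
rewrite -/(comp_coef eps inverse_coef n.+1) coef_trunc // inverse_coef_rec.
by rewrite addrC subrK.
Qed.

Lemma inverse_coef1 : inverse_coef 1 = 1.
Proof.
by rewrite inverse_coef_rec comp_coef1 ?inverse_coef0 // /eps /= mul0r subr0.
Qed.

Lemma inverse_coef2 : inverse_coef 2 = - f 2.
Proof.
rewrite inverse_coef_rec comp_coef2 ?inverse_coef0 // inverse_coef1.
by rewrite /eps /= mul0r expr1n mulr1 !add0r.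
Qed.

(** The sum of [3^-i] over [i >= 2] is [1/6]. *)
Let eps_norm n : poly_norm (trunc eps n) 3^-1 <= 6^-1.
Proof.
have h3 : 0 <= 3^-1 :> R by lra.
have h31 : 3^-1 < 1 :> R by lra.
have := @abs_bounded_geom R (fun i => f i.+2) 1 3^-1 h3 h31 (fun k => f_le1 _) n.
rewrite !poly_norm_trunc (_ : 1 / (1 - 3^-1) = 3 / 2); last by field.
move=> H.
apply: le_trans (_ : \sum_(i < n.+2) `|eps i| * 3^-1 ^+ i <= _).
  rewrite [leRHS]big_ord_recr /= big_ord_recr /= -addrA lerDl.
  by rewrite addr_ge0 // mulr_ge0 ?exprn_ge0.
rewrite 2!big_ord_recl /= /eps /= normr0 !mul0r !add0r.
rewrite (_ : \sum_(i < n) _ = 3^-1 ^+ 2 * \sum_(i < n) `|f i.+2| * 3^-1 ^+ i).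
  by move: H; set S := \sum_(i < n) _ => H; rewrite expr2; lra.
rewrite mulr_sumr; apply: eq_bigr => i _; rewrite /bump /= !add1n.
by rewrite [RHS]mulrCA -exprD.
Qed.

(** The majorant argument: in [phi = 'X - eps (phi)], a bound [3^-1] on the lower truncation gives
    [6^-1 + 6^-1 = 3^-1] for the next. *)
Lemma abs_bounded_inverse : abs_bounded inverse_coef 6^-1 3^-1.
Proof.
have h6 : 0 <= 6^-1 :> R by lra.
elim=> [|n IH]; first by rewrite poly_norm_trunc big_ord0; lra.
have -> : trunc inverse_coef n.+1 =
    take_poly n.+1 ('X - (trunc eps n.+1 \Po trunc inverse_coef n)).
  apply/polyP => i; rewrite coef_take_poly coef_poly ltnS; case: ifP => // le_in.
  rewrite coefB coefX inverse_coef_rec; congr (_ - _).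
  move: le_in; rewrite leq_eqVlt => /predU1P[->|lt_in]; first by rewrite -gain.
  by rewrite coef_comp_trunc ?inverse_coef0 // ltnS ltnW.
apply: le_trans (ler_poly_norm_take _ _ h6) _.
apply: le_trans (ler_poly_normD _ _ h6) _; rewrite poly_normN.
have X6 : poly_norm 'X 6^-1 = 6^-1 :> R.
  by rewrite /poly_norm size_polyX !big_ord_recl big_ord0 !coefX /= normr0 normr1; lra.
have := le_trans (ler_poly_norm_comp (trunc eps n.+1) h6 IH) (eps_norm n.+1).
by rewrite X6; lra.
Qed.

Definition inverse_fun y : R := limn (pseries inverse_coef y).

Lemma cvg_inverse_fun y : `|y| < 6^-1 ->
  pseries inverse_coef y @ \oo --> inverse_fun y.
Proof. by move=> y6; apply: is_cvg_pseries abs_bounded_inverse (ltW y6). Qed.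

Lemma inverse_fun_bound y : `|y| < 6^-1 -> `|inverse_fun y| <= 3^-1.
Proof. by move=> y6; apply: normr_limn_pseries abs_bounded_inverse (ltW y6). Qed.

Lemma inverse_funK y : `|y| < 6^-1 -> limn (pseries f (inverse_fun y)) = y.
Proof.
move=> y6.
have h3 : 0 <= 3^-1 :> R by lra.
have h31 : 3^-1 < 1 :> R by lra.
have fA := @abs_bounded_geom R f 1 3^-1 h3 h31 f_le1.
have H := is_cvg_pseries fA (inverse_fun_bound y6).
have h6 : 0 < 6^-1 :> R by lra.
have := pseries_comp_cvg inverse_coef0 h6 abs_bounded_inverse fA y6 (cvg_inverse_fun y6) H.
move=> /(cvg_lim (@norm_hausdorff _ _)) <-.
(* The composite series is ['X], whose partial sums are constant from order 2 on. *)
apply/cvg_lim => //; rewrite -(cvg_shiftn 2) /=.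
rewrite (_ : (fun _ => _) = fun=> y); first exact: cvg_cst.
apply/funext => n; rewrite /pseries /series /= addn2 2?big_nat_recl //=.
rewrite !comp_inverse_coef /= mul0r add0r mul1r expr1 big1 ?addr0 // => i _.
by rewrite comp_inverse_coef /= mul0r.
Qed.

Lemma continuous_inverse_fun y : `|y| < 6^-1 -> {for y, continuous inverse_fun}.
Proof. by move=> y6; apply: continuous_pseries abs_bounded_inverse y6. Qed.

Lemma inverse_fun0 : inverse_fun 0 = 0.
Proof. by rewrite /inverse_fun limn_pseries0 inverse_coef0. Qed.

Lemma inverse_fun_gt0 y : 0 < y -> y < 36^-1 -> 0 < inverse_fun y.
Proof.
move=> y0 y36.
have y6 : `|y| < 6^-1 by rewrite gtr0_norm //; lra.
have h6 : 0 < 6^-1 :> R by lra.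
(* [phi - 'X] has order 2 and norm at most [3^-1 + 6^-1] at radius [6^-1], whence [18 = 36 / 2].
   Below [36^-1], [18 y < 1]. *)
suff : y - 18 * y ^+ 2 <= inverse_fun y.
  apply: lt_le_trans; rewrite expr2 mulrA -{1}[y]mul1r -mulrBl mulr_gt0 //; lra.
apply: limr_ge; first exact: cvgP (cvg_inverse_fun y6).
near=> n; rewrite -[pseries _ y n]horner_trunc.
have n2 : (1 < n)%N by near: n; exact: nbhs_infty_gt.
have : `|(trunc inverse_coef n - 'X).[y]| <= 18 * y ^+ 2.
  apply: le_trans (horner_low_order (n := 2) h6 (ltW y6) _) _.
    move=> [|[|i]] // _; rewrite coefB coefX coef_trunc // ?(ltnW n2) //=.
      by rewrite inverse_coef0 subrr.
    by rewrite inverse_coef1 subrr.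
  rewrite gtr0_norm // invrK [y * 6]mulrC exprMn mulrA ler_wpM2r ?sqr_ge0 //.
  have := ler_poly_normD (trunc inverse_coef n) (- 'X) (ltW h6).
  rewrite poly_normN (_ : poly_norm 'X 6^-1 = 6^-1); last first.
    by rewrite /poly_norm size_polyX !big_ord_recl big_ord0 !coefX /= normr0 normr1; lra.
  by have := abs_bounded_inverse n; rewrite expr2; lra.
by rewrite hornerD hornerN hornerX ler_norml => /andP[H _]; lra.
Unshelve. all: by end_near.
Qed.

(** Serves existence of the expansion, which speaks of all small fugacities and not only of given
    values of [inverse_fun]. *)
Lemma inverse_fun_onto : exists2 d : R, 0 < d &
  forall z, 0 < z -> z < d -> exists y, [/\ 0 < y, y < 36^-1 & inverse_fun y = z].
Proof.
pose y0 : R := 72^-1.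
have y00 : 0 < y0 by rewrite /y0; lra.
have y036 : y0 < 36^-1 by rewrite /y0; lra.
exists (inverse_fun y0); first exact: inverse_fun_gt0.
move=> z z0 zd.
have := @IVT R inverse_fun 0 y0 z (ltW y00).
have C : {within `[0, y0], continuous inverse_fun}.
  apply: continuous_in_subspaceT => y; rewrite inE /= in_itv /= => /andP[? ?].
  by apply: continuous_inverse_fun; rewrite ger0_norm //; lra.
have zI : Num.min (inverse_fun 0) (inverse_fun y0) <= z <=
    Num.max (inverse_fun 0) (inverse_fun y0).
  by rewrite inverse_fun0 ge_min (ltW z0) le_max (ltW zd) orbT.
move=> /(_ C zI) [y]; rewrite in_itv /= => /andP[y_ge0 yy0] yz; exists y; split=> //.
- rewrite lt_neqAle y_ge0 andbT eq_sym; apply/negP => /eqP y_eq0.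
  by move: z0; rewrite -yz y_eq0 inverse_fun0 ltxx.
- exact: le_lt_trans yy0 y036.
Qed.

(** Serves uniqueness: a small density is reached at a fugacity inside the range where an expansion
    is assumed. *)
Lemma inverse_fun_small d : 0 < d -> exists e, [/\ 0 < e, e <= 36^-1 &
  forall y, 0 < y -> y < e -> 0 < inverse_fun y < d].
Proof.
move=> d0.
have C : {for (0 : R), continuous inverse_fun}.
  by apply: continuous_inverse_fun; rewrite normr0; lra.
have := (cvgrPdist_lt _ _).1 C d d0; rewrite inverse_fun0 => -[e /= e0 He].
exists (Num.min e 36^-1); split; first by rewrite lt_min e0; lra.
  by rewrite ge_min lexx orbT.
move=> y y0; rewrite lt_min => /andP[ye y36].
rewrite inverse_fun_gt0 //=.
have := He y; rewrite /= !sub0r !normrN (gtr0_norm y0) => /(_ ye).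
exact: le_lt_trans (ler_norm _).
Qed.

End InverseSeries.

(** * Grand canonical virial expansion *)

Section GrandCanonical.
Variable R : realType.

Lemma powR_5_2 : 2 `^ (5 / 2) = 2 * Num.sqrt 2 ^+ 3 :> R.
Proof.
rewrite mulrC powRrM powR12_sqrt // (_ : 5 = 5%:R :> R) // powR_mulrn ?sqrtr_ge0 //.
by rewrite (exprD _ 2 3) sqr_sqrtr.
Qed.

Variables (h m k T : R) (s : statistics).
Hypotheses (h_gt0 : 0 < h) (m_gt0 : 0 < m) (k_gt0 : 0 < k) (T_gt0 : 0 < T).

Let beta := inv_temp k T.
Let lam := thermal_wavelength h m beta.
Let sg : R := stat_sign s.
Let sg1 : `|sg| = 1. Proof. exact: stat_sign_norm. Qed.

Lemma inv_temp_gt0 : 0 < beta.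
Proof. by rewrite /beta /inv_temp divr_gt0 // mulr_gt0. Qed.

Lemma inv_tempV : beta^-1 = k * T.
Proof. by rewrite /beta /inv_temp div1r invrK. Qed.

Let lam_gt0 : 0 < lam.
Proof. by apply: thermal_wavelength_gt0 => //; exact: inv_temp_gt0. Qed.

Let dens1 : dens_coef sg 1 = 1.
Proof. by rewrite /= sqrtr1 expr1n divr1. Qed.

Let dens_le1 j : `|dens_coef sg j| <= 1.
Proof. exact: dens_coef_norm. Qed.

Let phi := inverse_coef (dens_coef sg).
Let Phi := inverse_fun (dens_coef sg).

Definition grand_coef : nat -> R := comp_coef (pres_coef sg) phi.

(** The inverse series contributes [- sg / 2^(3/2)] and the second pressure coefficient
    [sg / 2^(5/2)]. The sum is negative for Bose and positive for Fermi, the reverse of the signs in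
    the informal statement. *)
Lemma grand_coef2 : grand_coef 2 = - sg * (1 / 2 `^ (5 / 2)).
Proof.
rewrite /grand_coef /phi comp_coef2 ?inverse_coef0 // inverse_coef2 //.
rewrite inverse_coef1 // expr1n mulr1 /pres_coef powR_5_2.
rewrite dens1 divr1 mul1r /= expr1.
have w0 : Num.sqrt 2 != 0 :> R by rewrite sqrtr_eq0 -ltNge.
by field.
Qed.

Lemma grand_coef_cvg y : 0 < y -> y < 36^-1 ->
  pseries (fun n => grand_coef n.+1) y @ \oo --> fugacity_pressure sg (Phi y) / y.
Proof.
move=> y0 y36.
have y6 : `|y| < 6^-1 by rewrite gtr0_norm //; lra.
have h6 : 0 < 6^-1 :> R by lra.
have h3 : 0 <= 3^-1 :> R by lra.
have h31 : 3^-1 < 1 :> R by lra.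
apply: pseries_shift; first exact: lt0r_neq0.
  by rewrite /grand_coef /phi comp_coef0 ?inverse_coef0 // /pres_coef /= mul0r.
have b6 := inverse_fun_bound dens_le1 y6.
apply: (pseries_comp_cvg (inverse_coef0 _) h6 (abs_bounded_inverse dens_le1)
  (abs_bounded_pres sg1 h3 h31) y6 (cvg_inverse_fun dens_le1 y6)).
by apply: cvg_pressure => //; exact: le_lt_trans b6 h31.
Qed.

(** The factor [V / lambda^3] cancels: the variable becomes [d(z)] and the value [p(z) / d(z)], so
    [V] disappears. *)
Lemma grand_virial_cvg V z (a : nat -> R) : 0 < V -> 0 < z -> z < 2^-1 ->
  fugacity_density sg z != 0 ->
  virial_sum a (grand_number s h m beta V z * lam ^+ 3 / V)
      (grand_pressure s h m beta V z * V / (grand_number s h m beta V z * k * T)) <->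
  (pseries (fun n => a n.+1) (fugacity_density sg z) @ \oo -->
   fugacity_pressure sg z / fugacity_density sg z).
Proof.
move=> V0 z0 z2 d0; rewrite grand_pressureE // grand_numberE // -/lam -/sg.
have l0 : lam != 0 by exact: lt0r_neq0.
have V0' : V != 0 by exact: lt0r_neq0.
have k0 : k != 0 by exact: lt0r_neq0.
have T0 : T != 0 by exact: lt0r_neq0.
rewrite inv_tempV.
rewrite (_ : V / lam ^+ 3 * fugacity_density sg z * lam ^+ 3 / V = fugacity_density sg z);
  last by field; rewrite V0' l0.
rewrite (_ : _ / (_ * k * T) = fugacity_pressure sg z / fugacity_density sg z) //.
by field; rewrite d0 k0 T0 l0 V0'.
Qed.

Lemma grand_coefficients : coefficients_of (grand_virial_expansion s h m k T) grand_coef.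
Proof.
have dPhi y : 0 < y -> y < 36^-1 -> fugacity_density sg (Phi y) = y.
  move=> y0 y36; apply: (inverse_funK _ dens1 dens_le1) => //.
  by rewrite gtr0_norm //; lra.
split.
  move=> V V0; have [d d0 onto] := inverse_fun_onto dens_le1.
  near=> z.
  have z0 : 0 < z by near: z; exact: nbhs_right_gt.
  have z2 : z < 2^-1 by near: z; apply: nbhs_right_lt; lra.
  have zd : z < d by near: z; exact: nbhs_right_lt.
  have [y [y0 y36 yz]] := onto z z0 zd.
  have dz : fugacity_density sg z = y by rewrite -yz; exact: dPhi.
  apply/grand_virial_cvg => //; rewrite dz; first exact: lt0r_neq0.
  by rewrite -yz; exact: grand_coef_cvg.
move=> b Eb [//|n] _.
(* For uniqueness the volume [V = 1] suffices: the fugacities [Phi y] realise all small densities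
   [y]. *)
have [d /= d0 Hd] := Eb 1 ltr01.
have d'0 : 0 < Num.min d 2^-1 by rewrite lt_min d0; lra.
have [e [e0 e36 He]] := inverse_fun_small dens_le1 d'0.
pose l y := fugacity_pressure sg (Phi y) / y.
apply: (@pseries_unique _ (fun n => b n.+1) (fun n => grand_coef n.+1) e l) => // y y0 ye; last first.
  by apply: grand_coef_cvg => //; exact: lt_le_trans ye e36.
have y36 := lt_le_trans ye e36.
have /andP[z0] := He y y0 ye; rewrite lt_min => /andP[zd z2].
have dz := dPhi y y0 y36.
have := Hd (Phi y); rewrite /= sub0r normrN gtr0_norm // => /(_ zd z0).
move=> /grand_virial_cvg; rewrite dz; apply => //.
exact: lt0r_neq0.
Unshelve. all: by end_near.
Qed.

End GrandCanonical.

(** * Canonical virial expansion *)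

Section CanonicalGas.
Variable R : realType.

Lemma coef1_exp (p : {poly R}) n : p`_0 = 1 -> (p ^+ n)`_1 = n%:R * p`_1.
Proof.
move=> p0; have := congr1 (fun q : {poly R} => q`_0) (deriv_exp p n).
rewrite coef_deriv mulr1n => ->.
rewrite coefMn coefM big_ord1 subnn coef_deriv mulr1n -horner_coef0 horner_exp.
by rewrite horner_coef0 p0 expr1n mulr1 mulr_natl.
Qed.

(* The reciprocal of [q] is the geometric series composed with [1 - q]. *)
Lemma rational_expansion (p q : {poly R}) : q`_0 = 1 ->
  exists c : nat -> R, exists2 d : R, 0 < d &
    c 1%N = p`_1 - p`_0 * q`_1 /\
    forall u, `|u| < d -> 0 < q.[u] /\ pseries c u @ \oo --> p.[u] / q.[u].
Proof.
move=> q0; pose G i : R := (1 - q)`_i; pose F (i : nat) : R := 1.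
have G0 : G 0%N = 0 by rewrite /G coefB coef1 q0 subrr.
pose c n := \sum_(i < n.+1) p`_i * comp_coef F G (n - i).
have [t qE] : exists t : {poly R}, 1 - q = t * 'X.
  apply/dvdpP; have := dvdp_XsubCl (1 - q) 0; rewrite subr0 => ->.
  by rewrite /root horner_coef0 -/(G 0%N) G0.
(* As [1 - q = t * 'X] and [d <= 1], this makes the norm of [1 - q] at [d] at most [1/2], inside the
   disc of the geometric series. *)
pose d : R := (2 * (1 + poly_norm t 1))^-1.
have t0 : 0 <= poly_norm t 1 by rewrite poly_norm_ge0.
have d0 : 0 < d by rewrite invr_gt0; lra.
have d1 : d <= 1 by rewrite invf_le1; lra.
have qd : poly_norm (1 - q) d <= 2^-1.
  rewrite qE; have := poly_normMXaddC t 0 d; rewrite addr0 normr0 addr0 => ->.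
  apply: le_trans (_ : poly_norm t 1 * d <= _).
    by rewrite ler_wpM2r ?(ltW d0) // ler_poly_norm // ltW.
  by rewrite ler_pdivrMr; lra.
have Gb : abs_bounded G d 2^-1.
  move=> n; rewrite (_ : trunc G n = take_poly n (1 - q)) //.
  exact: le_trans (ler_poly_norm_take _ _ (ltW d0)) qd.
have Fb : abs_bounded F 2^-1 (1 / (1 - 2^-1)).
  apply: abs_bounded_geom; [lra|lra|] => k.
  by rewrite normr1.
exists c, d => //; split.
  rewrite /c !big_ord_recl big_ord0 /= subnn subn0 comp_coef0 // comp_coef1 //.
  by rewrite /F /G coefB coef1 /=; ring.
move=> u ud.
have w2 : `|(1 - q).[u]| <= 2^-1.
  exact: le_trans (ler_poly_norm_horner _ (ltW ud)) qd.
have quE : q.[u] = 1 - (1 - q).[u] by rewrite hornerD hornerN hornerC; ring.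
have qu0 : 0 < q.[u] by rewrite quE; move: w2; rewrite ler_norml => /andP[_]; lra.
split=> //.
apply: (@series_of_approx _ _ (fun n => p * (trunc F n \Po trunc G n)) d
    (poly_norm p d * (1 / (1 - 2^-1)))) => //.
- move=> n i lt_in; rewrite coefM /c; apply: eq_bigr => j _; congr (_ * _).
  by rewrite coef_comp_trunc // (leq_ltn_trans (leq_subr _ _)).
- move=> n; apply: le_trans (ler_poly_normM _ _ (ltW d0)) _.
  rewrite ler_wpM2l ?poly_norm_ge0 ?(ltW d0) //.
  exact: le_trans (ler_poly_norm_comp _ (ltW d0) (Gb n)) (Fb n).
- under eq_fun do rewrite hornerM horner_comp.
  apply: cvgM; first exact: cvg_cst.
  apply: (comp_trunc_cvg (ltW d0) Gb Fb (ltW ud) (w := (1 - q).[u])).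
    (* [G] lists the coefficients of a polynomial, so its partial sums are eventually constant. *)
    rewrite -(cvg_shiftn (size (1 - q))) /=.
    rewrite (_ : (fun _ => _) = fun=> (1 - q).[u]); first exact: cvg_cst.
    apply/funext => n; rewrite -[pseries _ _ _]horner_trunc.
    by rewrite (_ : trunc G _ = take_poly (n + size (1 - q)) (1 - q)) // take_poly_id // leq_addl.
  rewrite quE -[_^-1]mul1r.
  rewrite (_ : pseries F _ = series (geometric 1 (1 - q).[u])) //.
  by apply: cvg_geometric_series; lra.
Qed.

Lemma horner_rev n (e : nat -> R) (x : R) : x != 0 ->
  (\poly_(j < n.+1) e j).[x] = x ^+ n * (\poly_(i < n.+1) e (n - i)%N).[x^-1].
Proof.
move=> x0; rewrite !horner_poly mulr_sumr (reindex_inj rev_ord_inj) /=.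
apply: eq_bigr => i _; rewrite subSS mulrCA; congr (_ * _).
by rewrite exprVn exprB ?unitfE // -ltnS.
Qed.

Variables (h m k T : R) (s : statistics).
Hypotheses (h_gt0 : 0 < h) (m_gt0 : 0 < m) (k_gt0 : 0 < k) (T_gt0 : 0 < T).

Let beta := inv_temp k T.
Let lam := thermal_wavelength h m beta.
Let sg : R := stat_sign s.

Let lam_gt0 : 0 < lam.
Proof. by apply: thermal_wavelength_gt0 => //; exact: inv_temp_gt0. Qed.

(** [pc N] is [p(z) / z] cut at degree [N]; thus [e N j] is coefficient [N] of [p^j / j!], the
    coefficient of [x^j] in [Zcan]. *)
Let pc N := \poly_(i < N) pres_coef sg i.+1.
Let e N j : R := (pc N ^+ j)`_(N - j) / j`!%:R.

Lemma Zcan_poly N V : Zcan s h m beta V N = (\poly_(j < N.+1) e N j).[V / lam ^+ 3].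
Proof. by rewrite Zcan_comp comp_exp_scale // /pres_coef mul0r. Qed.

Let pc0 N : (pc N.+1)`_0 = 1.
Proof. by rewrite coef_poly /pres_coef /= sqrtr1 expr1n !divr1. Qed.

Let e_top N : e N.+1 N.+1 = N.+1`!%:R^-1.
Proof.
by rewrite /e subnn -horner_coef0 horner_exp horner_coef0 pc0 expr1n mul1r.
Qed.

(** The second term of the expansion in [V / lambda^3], for [N + 1] particles; the factor [N] makes
    it vanish for a single particle. *)
Let e_next N : e N.+1 N = N%:R * (sg / (2 * Num.sqrt 2 ^+ 3)) / N`!%:R.
Proof.
rewrite /e subSnn coef1_exp // coef_poly; case: N => [|N]; first by rewrite !mul0r.
rewrite /= /pres_coef /= expr1; congr (_ * _ / _).
by field; rewrite sqrtr_eq0 -ltNge.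
Qed.

(* In terms of [u = lambda^3 / V], [PV / NkT] is the rational function
   [num N u / den N u]. *)
Let den N : {poly R} := \poly_(i < N.+1) (N`!%:R * e N (N - i)%N).
Let num N : {poly R} := \poly_(i < N.+1) ((N - i)%N%:R / N%:R * (N`!%:R * e N (N - i)%N)).

(** With [P] the partition function as a polynomial in [x], the left side is [x P'(x) / (N P(x))].
    Reversal to [u = 1 / x] extracts [x^N] from both, and positivity of [den] gives that of [P], as
    [ln] requires. *)
Lemma pressure_ratio N V : (0 < N)%N -> 0 < V -> 0 < (den N).[lam ^+ 3 / V] ->
  pressure s h m beta N V * V / (N%:R * k * T) =
  (num N).[lam ^+ 3 / V] / (den N).[lam ^+ 3 / V].
Proof.
move=> N0 V0 Q0; pose x := V / lam ^+ 3; pose P := \poly_(j < N.+1) e N j.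
have x0 : 0 < x by rewrite divr_gt0 // exprn_gt0.
have xV : lam ^+ 3 / V = x^-1 by rewrite /x invf_div.
have xn0 := lt0r_neq0 x0.
have fN : N`!%:R != 0 :> R by rewrite pnatr_eq0 -lt0n fact_gt0.
have fN0 : 0 < N`!%:R :> R by rewrite ltr0n fact_gt0.
have Nn0 : N%:R != 0 :> R by rewrite pnatr_eq0 -lt0n.
rewrite xV in Q0 *.
have PE : P.[x] = N`!%:R^-1 * x ^+ N * (den N).[x^-1].
  rewrite /P horner_rev // mulrAC mulrC; congr (_ * _).
  rewrite !horner_poly mulr_sumr; apply: eq_bigr => i _.
  by rewrite !mulrA mulVf // mul1r.
have P'E : x * P^`().[x] = N%:R * N`!%:R^-1 * x ^+ N * (num N).[x^-1].
  have -> : x * P^`().[x] = (\poly_(j < N.+1) (j%:R * e N j)).[x].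
    have -> : \poly_(j < N.+1) (j%:R * e N j) = P^`() * 'X.
      apply/polyP => -[|i]; rewrite coefMX coef_poly /= ?mul0r //.
      rewrite coef_deriv coef_poly; case: ifP => _; last by rewrite mul0rn.
      by rewrite mulr_natl.
    by rewrite hornerM hornerX mulrC.
  rewrite (@horner_rev N (fun j => j%:R * e N j)) // mulrAC mulrC; congr (_ * _).
  rewrite !horner_poly mulr_sumr; apply: eq_bigr => i _.
  rewrite [RHS]mulrA; congr (_ * _).
  move: ((N - i)%:R : R) (e N (N - i)%N) => A B.
  by field; rewrite fN Nn0.
have P0 : 0 < P.[x] by rewrite PE !mulr_gt0 ?invr_gt0 ?exprn_gt0.
have D : is_derive V (1 : R) (fun W => ln (Zcan s h m beta W N))
    (P.[x]^-1 * (P^`().[x] * (lam ^+ 3)^-1)).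
  rewrite (_ : (fun W => _) = (@ln R \o (horner P \o (fun W => (lam ^+ 3)^-1 *: W)))); last first.
    by apply/funext => W /=; rewrite Zcan_poly /P -/lam mulrC.
  have Vx : (lam ^+ 3)^-1 *: V = x by rewrite /x mulrC.
  apply: is_derive1_comp.
    by rewrite /= Vx; exact: is_derive1_ln.
  apply: is_derive1_comp; first by rewrite Vx; exact: is_derive_poly.
  have := is_deriveZ (lam ^+ 3)^-1 (is_derive_id V (1 : R)).
  by move=> H; apply: is_derive_eq H _; rewrite scaler1.
rewrite /pressure derive1E derive_val inv_tempV.
have V_x : V = x * lam ^+ 3 by rewrite /x divfK // expf_neq0 // lt0r_neq0.
rewrite V_x.
have lam0 := lt0r_neq0 lam_gt0; have k0 := lt0r_neq0 k_gt0; have T0 := lt0r_neq0 T_gt0.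
have Pn0 := lt0r_neq0 P0.
transitivity (x * P^`().[x] / (N%:R * P.[x])).
  by field; rewrite lam0 Nn0 k0 T0 Pn0.
rewrite P'E PE.
by field; rewrite fN Nn0 (lt0r_neq0 Q0) expf_neq0.
Qed.

Lemma canonical_coefficients N : (0 < N)%N ->
  exists2 a : nat -> R, coefficients_of (virial_expansion s h m k T N) a &
    a 2%N = - sg * (1 / 2 `^ (5 / 2)) * (1 - 1 / N%:R).
Proof.
move=> N0.
have NR0 : 0 < N%:R :> R by rewrite ltr0n.
have Nn0 := lt0r_neq0 NR0.
have l3 : 0 < lam ^+ 3 by rewrite exprn_gt0.
have den0 : (den N)`_0 = 1.
  rewrite coef_poly /= subn0; case: N N0 {NR0 Nn0} => // n _.
  by rewrite e_top divff // pnatr_eq0 -lt0n fact_gt0.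
have num0 : (num N)`_0 = 1.
  by rewrite coef_poly /= subn0 divff // mul1r -[RHS]den0 coef_poly /= subn0.
have num1 : (num N)`_1 = (1 - 1 / N%:R) * (den N)`_1.
  rewrite !coef_poly; case: ifP => _; last by rewrite mulr0.
  by congr (_ * _); rewrite natrB //; field.
have [c [d d0 [c1 Hc]]] := rational_expansion (num N) den0.
pose F u := (num N).[u] / (den N).[u].
(* The virial variable is [N u] rather than [u], hence the powers of [N]. *)
pose a n : R := if n is n'.+1 then c n' / N%:R ^+ n' else 0.
have aE u : pseries (fun n => a n.+1) (N%:R * u) = pseries c u.
  apply/funext => n; rewrite /pseries /series /=; apply: eq_bigr => i _.
  by rewrite exprMn mulrA divfK // expf_neq0.
have aF y : 0 < y -> y < N%:R * d -> pseries (fun n => a n.+1) y @ \oo --> F (y / N%:R).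
  move=> y0 yd; rewrite (_ : y = N%:R * (y / N%:R)); last by rewrite mulrCA divff // mulr1.
  rewrite aE -mulrA [N%:R * _]mulrC divfK //.
  by apply: (Hc _ _).2; rewrite gtr0_norm ?divr_gt0 // ltr_pdivrMr // mulrC.
have vE V b : 0 < V -> lam ^+ 3 / V < d ->
    virial_sum b (N%:R * lam ^+ 3 / V) (pressure s h m beta N V * V / (N%:R * k * T)) <->
    pseries (fun n => b n.+1) (N%:R * (lam ^+ 3 / V)) @ \oo --> F (lam ^+ 3 / V).
  move=> V0 Vd; have u0 : 0 < lam ^+ 3 / V by rewrite divr_gt0.
  have Q0 : 0 < (den N).[lam ^+ 3 / V] by apply: (Hc _ _).1; rewrite gtr0_norm.
  by rewrite pressure_ratio // [N%:R * (_ / V)]mulrA.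
exists a; last first.
  (* Here [c 1 = - den_1 / N] with [den_1 = N (N - 1) sg / 2^(5/2)], and [a 2 = c 1 / N]. *)
  rewrite /a c1 expr1 num0 num1 mul1r coef_poly powR_5_2.
  case: N N0 {NR0 Nn0 den0 num0 num1 c d d0 c1 Hc F a aE aF vE} => // n _.
  rewrite subn1 /= e_next factS natrM.
  have n0 : n`!%:R != 0 :> R by rewrite pnatr_eq0 -lt0n fact_gt0.
  have w0 : Num.sqrt 2 != 0 :> R by rewrite sqrtr_eq0 -ltNge.
  have n1 : n.+1%:R = 1 + n%:R :> R by rewrite nat1r.
  have n1' : 1 + n%:R != 0 :> R by rewrite nat1r pnatr_eq0.
  by rewrite n1; field; rewrite n1' w0 n0.
split.
  rewrite /virial_expansion -/beta -/lam.
  near=> V.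
  have V0 : 0 < V by near: V; apply: nbhs_pinfty_gt; exact: num_real.
  have Vd : lam ^+ 3 / d < V by near: V; apply: nbhs_pinfty_gt; exact: num_real.
  have ud : lam ^+ 3 / V < d by rewrite ltr_pdivrMr // mulrC -ltr_pdivrMr.
  apply/vE => //; rewrite aE; apply: (Hc _ _).2.
  by rewrite gtr0_norm // divr_gt0.
move=> b [M [_ HM]] [//|n] _.
(* Volumes beyond [M'] lie where [b] is assumed valid and satisfy [u < d]; the densities [N u] then
   fill a right neighbourhood of [0]. *)
pose M' := Num.max M (lam ^+ 3 / d).
have M'0 : 0 < M' by rewrite lt_max divr_gt0 // orbT.
have D0 : 0 < N%:R * (lam ^+ 3 / M') by rewrite mulr_gt0 // divr_gt0.
apply: (@pseries_unique _ (fun n => b n.+1) (fun n => a n.+1) _ (fun y => F (y / N%:R)) D0) => y y0.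
  move=> yM; pose V := N%:R * lam ^+ 3 / y.
  have V0 : 0 < V by rewrite divr_gt0 // mulr_gt0.
  have VM : M' < V.
    by move: yM; rewrite /V mulrA ltr_pdivlMr // ltr_pdivlMr // mulrC.
  move: VM; rewrite gt_max => /andP[MV dV].
  have uE : lam ^+ 3 / V = y / N%:R by rewrite /V; field; rewrite ?Nn0 ?(lt0r_neq0 y0) ?(lt0r_neq0 lam_gt0).
  have := HM V MV; rewrite /= -/beta -/lam => /(vE V b V0); rewrite uE.
  rewrite mulrCA divff // mulr1; apply.
  by rewrite -uE ltr_pdivrMr // mulrC -ltr_pdivrMr.
move=> yM; apply: aF => //; apply: lt_le_trans yM _.
rewrite ler_pM2l // ler_pdivrMr // mulrC -ler_pdivrMr //.
by rewrite le_max lexx orbT.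
Unshelve. all: by end_near.
Qed.

End CanonicalGas.

(** * Both ensembles and the limit of large particle number *)

Theorem mainTheorem6 (R : realType) (h m k T : R) (s : statistics)
    (h_gt0 : 0 < h) (m_gt0 : 0 < m) (k_gt0 : 0 < k) (T_gt0 : 0 < T) :
  exists (a : nat -> nat -> R) (agrand : nat -> R),
    [/\ forall N : nat, (0 < N)%N ->
          coefficients_of (virial_expansion s h m k T N) (a N),
        coefficients_of (grand_virial_expansion s h m k T) agrand,
        forall N : nat, (0 < N)%N ->
          a N 2%N = - stat_sign s * (1 / 2 `^ (5 / 2)) * (1 - 1 / N%:R),
        exists N N' : nat,
          [/\ (0 < N)%N, (0 < N')%N & a N 2%N <> a N' 2%N]
      & (a N 2%N @[N --> \oo] --> agrand 2%N) /\
        agrand 2%N = - stat_sign s * (1 / 2 `^ (5 / 2))].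
Proof.
(* A dummy sequence at [N = 0] lets [choice] produce one family over all [N]. *)
have exN N : exists aN : nat -> R, (0 < N)%N ->
    coefficients_of (virial_expansion s h m k T N) aN /\
    aN 2%N = - stat_sign s * (1 / 2 `^ (5 / 2)) * (1 - 1 / N%:R).
  case: (posnP N) => [->|N0]; first by exists (fun=> 0).
  by have [a aN a2] := canonical_coefficients s h_gt0 m_gt0 k_gt0 T_gt0 N0; exists a.
have [a aP] := choice exN.
have a2 N (N0 : (0 < N)%N) := (aP N N0).2.
exists a, (grand_coef R s); split.
- by move=> N /aP[].
- exact: grand_coefficients.
- exact: a2.
(* The coefficient vanishes for one particle and not for two. *)
- exists 1%N, 2%N; split=> //; rewrite !a2 // divr1 subrr mulr0 => /esym/eqP.
  rewrite !mulf_eq0 oppr_eq0 -normr_eq0 stat_sign_norm oner_eq0 /= div1r invr_eq0.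
  rewrite gt_eqF ?powR_gt0 //= => /eqP; lra.
- split; last exact: grand_coef2.
  (* The shift skips [N = 0], where [a2] does not apply. *)
  rewrite grand_coef2 -cvg_shiftS; set C := - _ * _.
  rewrite (_ : [sequence a n.+1 2%N]_n = (fun n => C * (1 - n.+1%:R^-1))); last first.
    by apply/funext => n; rewrite /= a2 // [1 / n.+1%:R]div1r.
  have H : C * (1 - n.+1%:R^-1) @[n --> \oo] --> C * (1 - 0).
    apply: cvgM; first exact: cvg_cst.
    by apply: cvgB; [exact: cvg_cst | exact: cvg_harmonic].
  by rewrite subr0 mulr1 in H; exact: H.
Qed.
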